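(* (i) Let $E\subset\mathbb{R}^d$ be a non-empty bounded set. If $\overline{\dim}_BE=0$, then $\dim_{qA}E=0$. (ii) If $E=\{a_j\}_j\subseteq[0,1]$, where $\{a_j-a_{j+1}\}_j$ is a decreasing sequence, then $\dim_{qA}E=1$ if $\overline{\dim}_BE>0$, and otherwise $\dim_{qA}E=0$.
   Context: $B(x,R)$ denotes the ball with centre $x$ and radius $R$, and $N_r(A)$ is the least number of balls of radius $r$ needed to cover a bounded set $A$. The upper box dimension is $\overline{\dim}_BE=\limsup_{r\to0}\frac{\log N_r(E)}{-\log r}$. For $0\le\delta<1$ let $\overline{h_E}(\delta)=\inf\{\alpha\ge0:\exists b,c>0$ such that $\max_{x\in E}N_r(E\cap B(x,R))\le c(R/r)^\alpha$ for all $0<r\le R^{1+\delta}\le R\le b\}$. The quasi-Assouad dimension is $\dim_{qA}E=\lim_{\delta\to0}\overline{h_E}(\delta)$ (limit as $\delta\to0^+$ of a monotone function). *)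

(* Defs.v *)
From HB Require Import structures.
From mathcomp Require Import all_boot all_order all_algebra.
From mathcomp Require Import all_classical all_reals all_analysis.
From mathcomp Require Import ring.
Set Implicit Arguments.
Unset Strict Implicit.
Unset Printing Implicit Defensive.
Import Order.TTheory GRing.Theory Num.Theory.
Import numFieldNormedType.Exports.
Local Open Scope classical_set_scope.
Local Open Scope ring_scope.

(* R^d with the Euclidean distance. It is an alias of 'rV[R]_d because the
   canonical metric on 'rV[R]_d comes from the sup norm. *)
Definition euclidean (R : realType) (d : nat) : Type := 'rV[R]_d.

Section euclidean_metric.
Context (R : realType) (d : nat).

HB.instance Definition _ := Choice.copy (euclidean R d) 'rV[R]_d.

Definition eucl_dist (x y : euclidean R d) : R :=
  Num.sqrt (\sum_(i < d) (x ord0 i - y ord0 i) ^+ 2).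

Lemma eucl_distxx (x : euclidean R d) : eucl_dist x x = 0.
Proof.
by rewrite /eucl_dist big1 ?sqrtr0// => i _; rewrite subrr expr0n.
Qed.

Lemma eucl_dist_positivity (x y : euclidean R d) : eucl_dist x y = 0 -> x = y.
Proof.
move=> /eqP; rewrite sqrtr_eq0 => le0.
have s0 : \sum_(i < d) (x ord0 i - y ord0 i) ^+ 2 == 0.
  by rewrite eq_le le0 sumr_ge0// => i _; exact: sqr_ge0.
move: s0; rewrite psumr_eq0; last by move=> i _; exact: sqr_ge0.
move=> /allP s0; apply/rowP => i; apply/eqP.
by have := s0 i (mem_index_enum _); rewrite /= sqrf_eq0 subr_eq0.
Qed.

Lemma eucl_dist_sym (x y : euclidean R d) : eucl_dist x y = eucl_dist y x.
Proof.
by rewrite /eucl_dist; congr Num.sqrt; apply: eq_bigr => i _;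
  rewrite -sqrrN opprB.
Qed.

Lemma sum_cauchy_schwarz (u v : 'I_d -> R) :
  \sum_(i < d) u i * v i <=
  Num.sqrt (\sum_(i < d) u i ^+ 2) * Num.sqrt (\sum_(i < d) v i ^+ 2).
Proof.
set A := \sum_(i < d) u i ^+ 2; set B := \sum_(i < d) v i ^+ 2.
set C := \sum_(i < d) u i * v i.
have A0 : 0 <= A by apply: sumr_ge0 => i _; exact: sqr_ge0.
have B0 : 0 <= B by apply: sumr_ge0 => i _; exact: sqr_ge0.
have pol (s t : R) : 0 <= s ^+ 2 * A - s * t * C *+ 2 + t ^+ 2 * B.
  have -> : s ^+ 2 * A - s * t * C *+ 2 + t ^+ 2 * B =
      \sum_(i < d) (s * u i - t * v i) ^+ 2.
    rewrite /A /B /C !mulr_sumr -sumrMnl -sumrB -big_split /=.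
    by apply: eq_bigr => i _; ring.
  by apply: sumr_ge0 => i _; exact: sqr_ge0.
rewrite -sqrtrM//; apply: (le_trans (ler_norm _)).
rewrite -sqrtr_sqr ler_sqrt ?mulr_ge0//.
have [A00|A00] := eqVneq A 0.
  suff -> : C = 0 by rewrite expr0n/= mulr_ge0.
  rewrite /C big1// => i _; suff -> : u i = 0 by rewrite mul0r.
  move/eqP: A00; rewrite psumr_eq0; last by move=> j _; exact: sqr_ge0.
  move=> /allP/(_ i (mem_index_enum _)).
  by rewrite /= sqrf_eq0 => /eqP.
have Apos : 0 < A by rewrite lt_def A00.
have := pol C A.
have -> : C ^+ 2 * A - C * A * C *+ 2 + A ^+ 2 * B = A * (A * B - C ^+ 2).
  by ring.
by rewrite pmulr_rge0// subr_ge0.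
Qed.

Lemma eucl_dist_triangle (y x z : euclidean R d) :
  eucl_dist x z <= eucl_dist x y + eucl_dist y z.
Proof.
pose u i := x ord0 i - y ord0 i; pose v i := y ord0 i - z ord0 i.
have h0 (w : 'I_d -> R) : 0 <= \sum_(i < d) w i ^+ 2.
  by apply: sumr_ge0 => i _; exact: sqr_ge0.
rewrite /eucl_dist -[leRHS]ger0_norm ?addr_ge0 ?sqrtr_ge0//.
rewrite -[leRHS]sqrtr_sqr ler_sqrt ?sqr_ge0//.
rewrite sqrrD !sqr_sqrtr ?h0//.
have -> : \sum_(i < d) (x ord0 i - z ord0 i) ^+ 2 =
    \sum_(i < d) u i ^+ 2 + (\sum_(i < d) u i * v i) *+ 2
    + \sum_(i < d) v i ^+ 2.
  rewrite -sumrMnl -!big_split/=; apply: eq_bigr => i _.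
  by rewrite -sqrrD /u /v addrA subrK.
by rewrite lerD2r lerD2l lerMn2r/= sum_cauchy_schwarz.
Qed.

HB.instance Definition _ := @isMetric.Build R (euclidean R d) eucl_dist
  eucl_distxx eucl_dist_positivity eucl_dist_sym eucl_dist_triangle.

End euclidean_metric.

(* These notions apply to E : set (euclidean R d), and to subsets of the real
   line through E : set R^o, since the library puts the metric `|y - x| on R^o
   rather than on R. *)
Section dimensions.
Context (R : realType) (T : metricType R).
Implicit Types (E A : set T) (r delta : R).
Local Open Scope ereal_scope.

Definition metric_bounded E : Prop := exists x M, E `<=` ball x M.

(* N_r(A). Balls are open, with centres anywhere in T. The infimum is that of a
   set of natural numbers, hence a minimum; it is +oo when no finite family of
   balls of radius r covers A, which never happens for bounded A in R^d. *)
Definition covering_number (r : R) A : \bar R :=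
  ereal_inf [set (size s)%:R%:E |
    s in [set s : seq T | A `<=` \bigcup_(x in [set` s]) ball x r]].

Definition upper_box_dim E : \bar R :=
  limf_esup (fun r => lne (covering_number r E) / (- ln r)%:E) 0^'+.

Definition qA_exponents E delta : set R :=
  [set alpha | (0 <= alpha)%R /\
    exists b c : R, [/\ (0 < b)%R, (0 < c)%R &
      forall r rho : R, (0 < r)%R -> (r <= rho `^ (1 + delta))%R ->
        (rho `^ (1 + delta) <= rho)%R -> (rho <= b)%R ->
        ereal_sup [set covering_number r (E `&` ball x rho) | x in E]
          <= (c * (rho / r) `^ alpha)%:E]].

(* Valued in \bar R so that the infimum of an empty set of exponents is +oo. *)
Definition qA_h E delta : \bar R := ereal_inf (EFin @` qA_exponents E delta).

Definition qA_dim E : \bar R := lim (qA_h E delta @[delta --> 0^'+]).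

Lemma qA_h_nonincreasing E (delta1 delta2 : R) :
  (0 <= delta1 <= delta2)%R -> qA_h E delta2 <= qA_h E delta1.
Proof.
move=> /andP[d10 d12]; apply: le_ereal_inf; apply: image_subset.
move=> alpha [alpha0 [b [c [b0 c0 H]]]]; split => //.
exists (Num.min b 1%R), c; split => //; first by rewrite lt_min b0 ltr01.
move=> r rho r0 rrho rhole; rewrite le_min => /andP[rhob rho1].
have rho0 : (0 < rho)%R.
  exact: lt_le_trans r0 (le_trans rrho rhole).
have rho01 : (0 < rho <= 1)%R by rewrite rho0.
apply: H => //.
- by apply: (le_trans rrho); apply: ger_powR; rewrite ?lerD2l.
- by apply: ge1r_powR; rewrite ?lerDl.
Qed.

(* The limit defining qA_dim always exists. *)
Lemma is_cvg_qA_h E : cvg (qA_h E delta @[delta --> 0^'+]).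
Proof.
apply: nonincreasing_at_right_is_cvge; apply: nearW => e x y.
rewrite !in_itv/= => /andP[x0 _] _ xy.
by apply: qA_h_nonincreasing; rewrite (ltW x0).
Qed.

End dimensions.

(* Main.v *)
(** Local covering numbers are at most global ones, and the restriction
    [r <= rho ^ (1 + delta)] turns a small power of [1 / r] into a small power
    of [rho / r]; hence box dimension [0] forces quasi-Assouad dimension [0].
    For a decreasing sequence [a] with limit [L] and gaps [g_j], put
    [b_j = a_j - L]. If [g_j >= b_j ^ (1 + delta)] eventually, then [b_j] decays
    like [j ^ (- 1 / delta)] and the box dimension is at most [delta]. So if
    the box dimension exceeds [delta], then [g_j < b_j ^ (1 + delta)] for
    arbitrarily large [j]; the points beyond [a_j] are [g_j]-dense in
    [[L, a_j]], and the scales [r = g_j], [rho = 2 b_j] exclude every exponent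
    smaller than [1]. *)
Require Import Defs.
From mathcomp Require Import all_boot all_order all_algebra.
From mathcomp Require Import all_classical all_reals all_analysis.
From mathcomp Require Import lra.
Set Implicit Arguments.
Unset Strict Implicit.
Unset Printing Implicit Defensive.
Import Order.TTheory GRing.Theory Num.Theory.
Import numFieldNormedType.Exports.
Local Open Scope classical_set_scope.
Local Open Scope ring_scope.

(** * Covering and packing in a metric space *)

Section metric_dimensions.
Context (R : realType) (T : metricType R).
Implicit Types (E A B : set T) (r delta s : R).

Lemma covering_number_le A r (s : seq T) :
  A `<=` \bigcup_(x in [set` s]) ball x r ->
  (covering_number r A <= (size s)%:R%:E)%E.
Proof. by move=> As; apply: ereal_inf_lbound; exists s. Qed.

Lemma covering_number_ge0 A r : (0 <= covering_number r A)%E.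
Proof. by apply: le_ereal_inf_tmp => _ [s _ <-]; rewrite lee_fin. Qed.

Lemma le_covering_number A B r :
  A `<=` B -> (covering_number r A <= covering_number r B)%E.
Proof.
move=> AB; apply: ereal_inf_le_tmp => _ [s Bs <-]; exists s => //.
exact: subset_trans AB Bs.
Qed.

(** No ball of radius [r] contains two of the points, so choosing for each point a covering ball
    that contains it is an injection into the cover. *)
Lemma packing_le_covering_number n A r (x : 'I_n -> T) :
  (forall i, A (x i)) ->
  (forall i j y, ball y r (x i) -> ball y r (x j) -> i = j) ->
  (n%:R%:E <= covering_number r A)%E.
Proof.
move=> Ax xinj; apply: le_ereal_inf_tmp => _ [s As <-].
rewrite lee_fin ler_nat.
have /choice[f fP] i :
      exists k : 'I_(size s), ball (tnth (in_tuple s) k) r (x i).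
  have [y ys yx] := As _ (Ax i).
  have ks : (index y s < size s)%N by rewrite index_mem.
  by exists (Ordinal ks); rewrite (tnth_nth y)/= nth_index.
have finj : injective f.
  by move=> i j fij; apply: (xinj i j _ (fP i)); rewrite fij; exact: fP.
by have := leq_card f finj; rewrite !card_ord.
Qed.

(** * Upper box dimension as a power bound on covering numbers *)

Lemma upper_box_dim_lt E s : (upper_box_dim E < s%:E)%E ->
  \forall r \near 0^'+, (covering_number r E <= (r `^ (- s))%:E)%E.
Proof.
move=> /ereal_inf_lt[_ [V FV <-] supV]; near=> r.
have r0 : 0 < r by near: r; exact: nbhs_right_gt.
have r1 : r < 1 by near: r; exact: nbhs_right_lt.
have : (lne (covering_number r E) / (- ln r)%:E <= s%:E)%E.
  apply/ltW/(le_lt_trans _ supV)/ereal_sup_ubound; exists r => //.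
  by near: r.
have lr : 0 < - ln r by rewrite oppr_gt0 ln_lt0// r0.
rewrite inver gt_eqF// lee_pdivrMr// => lneN.
rewrite /powR gt_eqF// -[leLHS]lneK ?in_itv/= ?covering_number_ge0 ?leey//.
apply: le_trans (_ : expeR (s * - ln r)%:E <= _)%E; first
  by rewrite lee_expeR EFinM.
by rewrite /= mulrN mulNr.
Unshelve. all: by end_near. Qed.

Lemma upper_box_dim_le E s :
  (\forall r \near 0^'+, (covering_number r E <= (r `^ (- s))%:E)%E) ->
  (upper_box_dim E <= s%:E)%E.
Proof.
move=> Ns; apply: ge_ereal_inf.
(* The upper limit is an infimum over neighbourhoods; the one chosen also imposes [0 < r < 1], which
   makes [- ln r] a positive divisor. *)
exists (ereal_sup [set (lne (covering_number r E) / (- ln r)%:E)%E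
   | r in [set r | (covering_number r E <= (r `^ (- s))%:E)%E /\ 0 < r < 1]]).
  exists [set r | (covering_number r E <= (r `^ (- s))%:E)%E /\ 0 < r < 1] => //.
  near=> r; split; first by near: r.
  apply/andP; split; near: r; [exact: nbhs_right_gt|exact: nbhs_right_lt].
apply: ge_ereal_sup => _ [r [Nr /andP[r0 r1]] <-].
have lr : 0 < - ln r by rewrite oppr_gt0 ln_lt0// r0.
rewrite inver gt_eqF// lee_pdivrMr//.
rewrite -lee_expeR lneK ?in_itv/= ?covering_number_ge0 ?leey//.
apply: (le_trans Nr); rewrite /powR gt_eqF//=.
by rewrite mulrN mulNr.
Unshelve. all: by end_near. Qed.

(** * Quasi-Assouad exponents of sets of box dimension zero *)

Lemma qA_h_le E delta s : qA_exponents E delta s -> (qA_h E delta <= s%:E)%E.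
Proof. by move=> Es; apply: ereal_inf_lbound; exists s. Qed.

Lemma qA_h_ge0 E delta : (0 <= qA_h E delta)%E.
Proof. by apply: le_ereal_inf_tmp => _ [s [s0 _] <-]; rewrite lee_fin. Qed.

Lemma qA_dim_near E (l : \bar R) :
  (\forall delta \near 0^'+, qA_h E delta = l) -> qA_dim E = l.
Proof. by move=> ?; apply: lim_near_cst. Qed.

(* At scales [r <= rho ^ (1 + delta)] one has
   [r ^ (-1) <= (rho / r) ^ ((1 + delta) / delta)], so that a global bound
   [N_r(E) <= r ^ (- eps)] is a local one with exponent
   [eps * (1 + delta) / delta]. *)
Lemma qA_h_eq0 E delta :
  (upper_box_dim E <= 0)%E -> 0 < delta -> qA_h E delta = 0%E.
Proof.
move=> E0 d0; apply/eqP; rewrite eq_le qA_h_ge0 andbT.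
apply/lee_addgt0Pr => alpha alpha0; rewrite add0e; apply: qA_h_le.
split; first exact: ltW.
pose eps := alpha * (delta / (1 + delta)).
have d10 : 0 < 1 + delta by lra.
have eps0 : 0 < eps by rewrite mulr_gt0 ?divr_gt0.
have [b /= b0 Eb] : exists2 b, 0 < b & forall r, 0 < r -> r < b ->
    (covering_number r E <= (r `^ (- eps))%:E)%E.
  have /upper_box_dim_lt : (upper_box_dim E < eps%:E)%E.
    by apply: (le_lt_trans E0); rewrite lte_fin.
  move=> /nbhs_right0P [b /= b0 H]; exists b => // r r0 rb.
  have := H r; rewrite /= sub0r normrN gtr0_norm// add0r; exact.
exists (Num.min (b / 2) 1), 1; split => //.
  by rewrite lt_min ltr01 divr_gt0.
move=> r rho r0 rrho rhole; rewrite le_min => /andP[rhob rho1].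
have rho0 : 0 < rho by exact: lt_le_trans r0 (le_trans rrho rhole).
apply: ge_ereal_sup => _ [x Ex <-]; rewrite mul1r.
apply: (le_trans (le_covering_number _ (@subIsetl _ _ _))).
apply: (le_trans (Eb r r0 _)).
  by apply: (le_lt_trans (le_trans rrho (le_trans rhole rhob))); lra.
rewrite lee_fin /powR !gt_eqF ?divr_gt0// ler_expR ln_div// mulNr -mulrN.
(* After taking logarithms and cancelling [alpha], the claim amounts to
   [ln r <= (1 + delta) * ln rho]. *)
rewrite -mulrA ler_pM2l// mulrAC ler_pdivrMr//.
have : ln r <= (1 + delta) * ln rho.
  by rewrite -ln_powR ler_ln ?posrE ?powR_gt0.
nra.
Qed.

Lemma qA_dim_eq0 E : (upper_box_dim E <= 0)%E -> qA_dim E = 0%E.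
Proof.
move=> E0; apply: qA_dim_near; near=> delta; exact: qA_h_eq0.
Unshelve. all: by end_near. Qed.

End metric_dimensions.

(** * Subsets of the line: the upper bound 1 *)

Section real_line.
Context (R : realType).
Implicit Types (E A : set R^o) (r rho delta : R) (a : nat -> R).

Lemma ball_regular (x y : R) r : ball (x : R^o) r y = (`|x - y| < r) :> Prop.
Proof. by rewrite -ball_normE. Qed.

(** The centres form a grid of step [r] starting at [x - rho]. It has at most [2 * (rho / r) + 1]
    nodes, and [r <= rho] absorbs the 1. *)
Lemma covering_number_interval A (x : R) r rho : 0 < r -> r <= rho ->
  A `<=` ball (x : R^o) rho -> (covering_number r A <= (3 * (rho / r))%:E)%E.
Proof.
move=> r0 rrho Ax; have rho0 : 0 < rho by exact: lt_le_trans rrho.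
pose n := (Num.truncn (2 * (rho / r))).+1.
pose s : seq R := [seq x - rho + i%:R * r | i <- iota 0 n].
apply: (@le_trans _ _ (size s)%:R%:E).
  apply: (@covering_number_le _ R^o) => y /Ax.
  have [z ->] : exists z : R, y = z by exists y.
  rewrite ball_regular ltr_norml => /andP[xy1 xy2].
  pose t : R := (z - x + rho) / r.
  have tr : t * r = z - x + rho by rewrite divfK// gt_eqF.
  have t0 : 0 <= t by rewrite divr_ge0 ?(ltW r0)//; lra.
  have tn : t <= 2 * (rho / r).
    by rewrite mulrA ler_pM2r ?invr_gt0//; lra.
  exists (x - rho + (Num.truncn t)%:R * r).
    apply/mapP; exists (Num.truncn t) => //.
    by rewrite mem_iota/= add0n ltnS; exact: le_truncn.
  rewrite ball_regular; have /andP[h1 h2] := truncn_itv t0.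
  rewrite -(ler_pM2r r0) in h1; rewrite -natr1 -(ltr_pM2r r0) mulrDl mul1r in h2.
  by rewrite ltr_norml; apply/andP; split; lra.
rewrite lee_fin size_map size_iota /n -natr1.
have h1 : (Num.truncn (2 * (rho / r)))%:R <= 2 * (rho / r).
  by rewrite truncn_le mulr_ge0 ?divr_ge0 ?ltW.
have : 1 <= rho / r by rewrite ler_pdivlMr ?mul1r.
lra.
Qed.

Lemma qA_h_le1 E delta : (qA_h E delta <= 1)%E.
Proof.
apply: qA_h_le; split => //; exists 1, 3; split => // r rho r0 rrho rhole _.
have rho0 : 0 < rho by exact: lt_le_trans r0 (le_trans rrho rhole).
apply: ge_ereal_sup => _ [x Ex <-].
rewrite powRr1; last exact: ltW (divr_gt0 rho0 r0).
by apply: (@covering_number_interval _ x) => //; exact: le_trans rhole.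
Qed.

(** * Sequences with large gaps: decay and box dimension *)

Lemma nonincreasing_of_gaps a (M : R) : (forall j, a j <= M) ->
  nonincreasing_seq (fun j => a j - a j.+1) -> nonincreasing_seq a.
Proof.
move=> aM gap; apply/nonincreasing_seqP => j; rewrite leNgt; apply/negP => aj.
(* Decreasing gaps make every later step rise by at least [g] too, which carries the sequence past
   [M]. *)
pose g := a j.+1 - a j; have g0 : 0 < g by rewrite subr_gt0.
have ajk k : a j + k%:R * g <= a (j + k)%N.
  elim: k => [|k IH]; first by rewrite mul0r addr0 addn0.
  have := gap j (j + k)%N (leq_addr _ _); rewrite addnS -natr1 /= /g in IH *.
  lra.
pose k := (Num.truncn ((M - a j) / g)).+1.
have : (M - a j) / g < k%:R by exact: truncnS_gt.
rewrite ltr_pdivrMr// ltNge => /negP; apply.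
by have := ajk k; have := aM (j + k)%N; lra.
Qed.

(* [t ^ (- delta)] increases by at least [delta] when [t] is replaced by
   [t - t ^ (1 + delta)], as [(1 - u) ^ (- delta) >= exp (delta * u)]. *)
Lemma polynomial_decay (b : nat -> R) delta : 0 < delta ->
  (forall j, 0 <= b j) -> (forall j, b j `^ (1 + delta) <= b j - b j.+1) ->
  forall k, 0 < b k -> delta * k%:R <= b k `^ (- delta).
Proof.
move=> d0 b0 bgap; elim=> [|k IH] bk1; first by rewrite mulr0 powR_ge0.
have bk : 0 < b k.
  apply: (lt_le_trans bk1); rewrite -subr_ge0.
  exact: le_trans (powR_ge0 _ _) (bgap k).
pose u := b k `^ delta.
have u0 : 0 < u by exact: powR_gt0.
have bu : b k.+1 <= b k * (1 - u).
  have := bgap k; rewrite powRD ?(gt_eqF bk) ?implybT// powRr1 ?(ltW bk)// -/u; lra.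
have bexp : b k.+1 <= b k * expR (- u).
  apply: (le_trans bu); rewrite ler_pM2l//; exact: expR_ge1Dx.
have : (b k * expR (- u)) `^ (- delta) <= b k.+1 `^ (- delta).
  rewrite !powRN lef_pV2 ?posrE ?powR_gt0 ?mulr_gt0 ?expR_gt0//.
  apply: ge0_ler_powR bexp; rewrite ?nnegrE; first exact: ltW.
    exact: ltW.
  by rewrite mulr_ge0 ?expR_ge0 ?ltW.
apply: le_trans; rewrite powRM ?expR_ge0 ?(ltW bk)//.
have -> : expR (- u) `^ (- delta) = expR (delta * u).
  by rewrite /powR gt_eqF ?expR_gt0// expRK mulrNN.
apply: (@le_trans _ _ (b k `^ (- delta) * (1 + delta * u))); last first.
  by rewrite ler_pM2l ?powR_gt0// expR_ge1Dx.
(* The factor in front is the inverse of [u], so the linear term contributes exactly [delta]. *)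
have -> : b k `^ (- delta) * (1 + delta * u) = b k `^ (- delta) + delta.
  by rewrite powRN -/u mulrDr mulr1 mulrCA mulVf ?mulr1// gt_eqF.
by rewrite -natr1 mulrDr mulr1 lerD2r; exact: IH.
Qed.

(** One ball at [L] takes care of the tail, which decays polynomially from index [J] on; each
    earlier point gets its own ball. *)
Lemma upper_box_dim_polynomial_decay a (L delta : R) J : 0 < delta ->
  (forall j, L <= a j) -> nonincreasing_seq a ->
  (forall j, (J <= j)%N -> (a j - L) `^ (1 + delta) <= a j - a j.+1) ->
  (upper_box_dim (range a : set R^o) <= delta%:E)%E.
Proof.
move=> d0 La amono agap.
apply/lee_addgt0Pr => eta eta0; apply: upper_box_dim_le.
(* The cover will have [J + m + 1] balls, at most [C] times the power [- delta] of [r]; for small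
   [r] the constant [C] is absorbed by the power [- eta]. *)
pose C : R := J%:R + 2 + delta^-1.
have C0 : 0 < C by rewrite addr_gt0 ?invr_gt0// addr_ge0.
near=> r.
have r0 : 0 < r by near: r; exact: nbhs_right_gt.
have r1 : r < 1 by near: r; exact: nbhs_right_lt.
have rC : r <= C^-1 `^ eta^-1.
  by near: r; apply: nbhs_right_le; rewrite powR_gt0 ?invr_gt0.
(* This is large enough that [delta * m] exceeds the power [- delta] of [r]; by the decay estimate,
   no point from index [J + m] on is at distance [r] or more from [L]. *)
pose m := (Num.truncn (r `^ (- delta) / delta)).+1.
pose s : seq R := L :: [seq a i | i <- iota 0 (J + m)].
have small j : (J + m <= j)%N -> a j - L < r.
  move=> jm; rewrite ltNge; apply/negP => rj.
  have rJm : r <= a (J + m)%N - L by apply: (le_trans rj); rewrite lerD2r amono.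
  have decay := @polynomial_decay (fun k => a (J + k)%N - L) delta d0.
  have : delta * m%:R <= (a (J + m)%N - L) `^ (- delta).
    apply: decay => [k|k|].
    - by rewrite subr_ge0.
    - by rewrite addnS (le_trans (agap (J + k)%N (leq_addr _ _)))//; lra.
    - exact: lt_le_trans rJm.
  apply/negP; rewrite -ltNge.
  apply: (@le_lt_trans _ _ (r `^ (- delta))).
    rewrite !powRN lef_pV2 ?posrE ?powR_gt0//; last exact: lt_le_trans rJm.
    apply: ge0_ler_powR rJm; rewrite ?nnegrE; first exact: ltW.
      exact: ltW.
    by rewrite subr_ge0.
  by rewrite mulrC -ltr_pdivrMr// truncnS_gt.
apply: (@le_trans _ _ (size s)%:R%:E).
  apply: (@covering_number_le _ R^o) => _ [j _ <-].
  have [jm|jm] := leqP (J + m) j.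
    exists L; first exact: mem_head.
    rewrite ball_regular distrC ger0_norm ?subr_ge0//; exact: small.
  exists (a j); last exact: ballxx.
  rewrite /= inE; apply/orP; right; apply/mapP; exists j => //.
  by rewrite mem_iota.
rewrite lee_fin /= size_map size_iota opprD powRD ?(gt_eqF r0) ?implybT//.
have rd1 : 1 <= r `^ (- delta).
  by rewrite -[leLHS](powRr0 r); apply: ger_powR; rewrite ?r0 ?(ltW r1)//= oppr_le0 ltW.
have Ceta : C <= r `^ (- eta).
  rewrite powRN -[leLHS]invrK lef_pV2 ?posrE ?invr_gt0 ?powR_gt0//.
  have := @ge0_ler_powR _ eta (ltW eta0) r (C^-1 `^ eta^-1).
  rewrite !nnegrE powR_ge0 (ltW r0) => /(_ isT isT rC).
  by rewrite -powRrM mulVf ?gt_eqF// powRr1// invr_ge0 (ltW C0).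
have mle : m%:R <= r `^ (- delta) / delta + 1.
  by rewrite /m -natr1 lerD2r truncn_le divr_ge0 ?powR_ge0 ?ltW.
have mulC : r `^ (- delta) * C <= r `^ (- delta) * r `^ (- eta).
  by rewrite ler_pM2l ?powR_gt0.
apply: le_trans mulC; rewrite -natr1 natrD /C.
have : 0 <= J%:R :> R by [].
nra.
Unshelve. all: by end_near. Qed.

(** * Sequences with small gaps: the lower bound 1 *)

Lemma qA_h_ge1 a (L delta : R) : 0 < delta ->
  (forall j, L <= a j) -> (forall e, 0 < e -> exists j, a j - L < e) ->
  nonincreasing_seq a -> nonincreasing_seq (fun j => a j - a j.+1) ->
  (forall J, exists2 j, (J <= j)%N & a j - a j.+1 < (a j - L) `^ (1 + delta)) ->
  (1 <= qA_h (range a : set R^o) delta)%E.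
Proof.
move=> d0 La aL amono gap often.
apply: le_ereal_inf_tmp => _ [alpha [alpha0 [b [c [b0 c0 H]]]] <-].
rewrite lee_fin leNgt; apply/negP => alpha1.
(* With [B = a j - L], an exponent [alpha < 1] will force the power [- p] of [B] to be at most
   [8 * c], which fails for small [B]. *)
pose p := delta * (1 - alpha).
have p0 : 0 < p by rewrite mulr_gt0// subr_gt0.
have c8 : 0 < (8 * c)^-1 by rewrite invr_gt0 mulr_gt0.
(* The first two bounds keep [rho = 2 * B] below [b] and 1; the third gives the final
   contradiction. *)
pose e := Num.min (Num.min (b / 2) (1 / 2)) ((8 * c)^-1 `^ p^-1).
have e0 : 0 < e by rewrite !lt_min !divr_gt0//= powR_gt0.
have [J aJ] := aL e e0.
have [j Jj gj] := often J.
pose B := a j - L; pose r := a j - a j.+1; pose rho := 2 * B.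
have Be : B < e by apply: le_lt_trans aJ; rewrite lerD2r amono.
have {Be} : [/\ B < b / 2, B < 1 / 2 & B < (8 * c)^-1 `^ p^-1].
  by move: Be; rewrite !lt_min => /andP[/andP[]].
move=> [Bb B1 Bp].
have r_ge0 : 0 <= r by rewrite subr_ge0 amono.
have B0 : 0 < B.
  rewrite lt_neqAle subr_ge0 La andbT; apply/eqP => B0.
  move: gj; rewrite -/B -B0 powR0 ?gt_eqF//; last by lra.
  by rewrite ltNge r_ge0.
have gaps k : (j <= k)%N -> a k - a k.+1 <= r by exact: gap.
(* If [r] were 0, no later gap would be positive and the sequence could not descend from [a j]
   towards [L]. *)
have r0 : 0 < r.
  rewrite lt_neqAle r_ge0 andbT; apply/eqP => r0.
  have aconst k : a j <= a (j + k)%N.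
    elim: k => [|k IH]; first by rewrite addn0.
    have := gaps (j + k)%N (leq_addr _ _); rewrite -r0 addnS; lra.
  have [k ak] := aL B B0.
  have := aconst k; have := amono k (j + k)%N (leq_addl _ _).
  rewrite /B in ak *; lra.
(* Take the first index from [j] on with [a k <= t]: unless [k = j], its predecessor lies above [t]
   and the gap between them is at most [r]. *)
have point t : L < t <= a j -> exists k, [/\ (j <= k)%N, t - r < a k & a k <= t].
  move=> /andP[Lt taj].
  have ex : exists k, (j <= k)%N && (a k <= t).
    have [k ak] := aL (t - L) ltac:(by rewrite subr_gt0).
    exists (j + k)%N; rewrite leq_addr/=.
    have := amono k (j + k)%N (leq_addl _ _); lra.
  have := ex_minnP ex; case => k /andP[jk akt] kmin; exists k; split => //.
  have [jk'|kj] := ltnP j k; last first.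
    have -> : k = j by apply/eqP; rewrite eqn_leq kj.
    lra.
  case: k jk akt kmin jk' => // k _ _ kmin jk.
  have akt : t < a k.
    rewrite ltNge; apply/negP => akt.
    by have := kmin k; rewrite akt -ltnS jk ltnn => /(_ isT).
  have := gaps k jk; lra.
(* The targets [a j - 3 * (i * r)] with [i < n] stay above [L]. Approximating them within [r] leaves
   distances above [2 * r], so no ball of radius [r] contains two of the points found. *)
pose n := (Num.truncn (B / (4 * r))).+1.
have n_gt : B / (4 * r) < n%:R by exact: truncnS_gt.
have n_le (i : 'I_n) : 4 * (i%:R * r) <= B.
  have : i%:R <= B / (4 * r).
    apply: (@le_trans _ _ (Num.truncn (B / (4 * r)))%:R).
      by rewrite ler_nat -ltnS.
    by rewrite truncn_le divr_ge0 ?mulr_ge0 ?ltW.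
  by rewrite ler_pdivlMr ?mulr_gt0// mulrCA.
have /choice[f fP] (i : 'I_n) : exists k,
    [/\ (j <= k)%N, a j - 3 * (i%:R * r) - r < a k
      & a k <= a j - 3 * (i%:R * r)].
  apply: point; have := n_le i; have : 0 <= i%:R * r by rewrite mulr_ge0.
  rewrite /B in B0 *; lra.
have sep (i k : 'I_n) : (i < k)%N -> 2 * r < a (f i) - a (f k).
  move=> ik; have [_ fi _] := fP i; have [_ _ fk] := fP k.
  have : (i%:R + 1) * r <= k%:R * r by rewrite ler_pM2r// natr1 ler_nat.
  lra.
pose E : set R^o := range a.
have Nle : (n%:R%:E <= covering_number r (E `&` ball (a j : R^o) rho))%E.
  apply: (@packing_le_covering_number _ _ _ _ _ (fun i => a (f i) : R^o)).
    move=> i; split; first by exists (f i).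
    have [jf _ _] := fP i.
    rewrite ball_regular ger0_norm ?subr_ge0 ?amono//.
    have := La (f i); rewrite /rho /B in B0 *; lra.
  move=> i k y; have [z ->] : exists z : R, y = z by exists y.
  rewrite !ball_regular !ltr_norml => /andP[h1 h2] /andP[h3 h4].
  apply/val_inj; case: (ltngtP i k) => // /sep ik; exfalso; lra.
have rhole : rho `^ (1 + delta) <= rho.
  apply: ge1r_powR; last by lra.
  by rewrite /rho; apply/andP; split; lra.
have rrho : r <= rho `^ (1 + delta).
  apply: (le_trans (ltW gj)); apply: ge0_ler_powR; rewrite ?nnegrE -/B /rho; lra.
have := H r rho r0 rrho rhole ltac:(rewrite /rho; lra).
have /ereal_sup_ubound : [set covering_number r (E `&` ball x rho) | x in E]
  (covering_number r (E `&` ball (a j : R^o) rho)) by exists (a j) => //; exists j.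
move=> /(le_trans Nle) /le_trans h /h {h}; rewrite lee_fin => nle.
pose X := B / r.
have X0 : 0 < X by rewrite divr_gt0.
(* Here [X / 4 < n], while the covering bound with [rho / r = 2 * X] gives at most [2 * c] times the
   power [alpha] of [X]. *)
have Xle : X <= 8 * c * X `^ alpha.
  have XE : B / (4 * r) = X / 4 by rewrite invfM mulrCA mulrC.
  have alpha2 : 2 `^ alpha <= 2 :> R.
    by rewrite -[leRHS]powRr1//; apply: ler_powR; rewrite ?ler1n// ltW.
  have : n%:R <= c * (2 * X) `^ alpha by rewrite mulrA.
  rewrite powRM ?(ltW X0)// => nX.
  have : c * (2 `^ alpha * X `^ alpha) <= c * (2 * X `^ alpha).
    by rewrite ler_pM2l// ler_pM2r ?powR_gt0.
  rewrite XE in n_gt; lra.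
have X1 : X `^ (1 - alpha) <= 8 * c.
  by rewrite powRB ?(gt_eqF X0) ?implybT// powRr1 ?(ltW X0)// ler_pdivrMr ?powR_gt0.
(* This is where the smallness of the gap, [r] below the power [1 + delta] of [B], enters. *)
have BX : B `^ (- delta) <= X.
  rewrite powRN /X ler_pdivlMr// mulrC ler_pdivrMr ?powR_gt0//.
  by apply: (le_trans (ltW gj)); rewrite -/B powRD ?(gt_eqF B0) ?implybT// powRr1 ?(ltW B0).
have : B `^ (- p) <= 8 * c.
  apply: le_trans X1; rewrite /p -mulNr powRrM; apply: ge0_ler_powR => //.
  - by rewrite subr_ge0 ltW.
  - by rewrite nnegrE powR_ge0.
  - by rewrite nnegrE ltW.
apply/negP; rewrite -ltNge powRN -[ltLHS]invrK ltf_pV2 ?posrE ?powR_gt0//.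
have := @gt0_ltr_powR _ p p0 B ((8 * c)^-1 `^ p^-1).
rewrite !nnegrE powR_ge0 (ltW B0) => /(_ isT isT Bp).
by rewrite -powRrM mulVf ?gt_eqF// powRr1// (ltW c8).
Qed.

End real_line.

(** * The dichotomy for decreasing sequences *)

Theorem proposition9 (R : realType) :
  (forall (d : nat) (E : set (euclidean R d)),
     E !=set0 -> metric_bounded E ->
     upper_box_dim E = 0%E -> qA_dim E = 0%E)
  /\
  (forall (a : nat -> R) (E : set R^o),
     E = range a -> E `<=` `[0, 1] ->
     nonincreasing_seq (fun j : nat => a j - a j.+1) ->
     ((0 < upper_box_dim E)%E -> qA_dim E = 1%E) /\
     (~ (0 < upper_box_dim E)%E -> qA_dim E = 0%E)).
Proof.
split=> [d E _ _ E0|a _ -> a01 gap]; first by apply: qA_dim_eq0; rewrite E0.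
split=> [E0|/negP]; last by rewrite -leNgt; exact: qA_dim_eq0.
have a_itv j : 0 <= a j <= 1.
  by have /= := a01 (a j) (ex_intro2 _ _ j I erefl); rewrite in_itv.
have amono : nonincreasing_seq a.
  by apply: (@nonincreasing_of_gaps _ _ 1) => // j; case/andP: (a_itv j).
pose L := inf (range a).
have ainf : has_inf (range a).
  split; first by exists (a 0%N), 0%N.
  by exists 0 => _ [j _ <-]; case/andP: (a_itv j).
have La j : L <= a j by apply: ge_inf; [exact: ainf.2|exists j].
have aL e : 0 < e -> exists j, a j - L < e.
  by move=> /inf_adherent/(_ ainf)[_ [j _ <-]]; exists j; rewrite ltrBlDl.
have [s s0 sE] : exists2 s : R,
    0 < s & (s%:E < upper_box_dim (range a : set R^o))%E.
  (* A real [s] strictly below the dimension is half of it when finite, and 1 in the infinite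
     case. *)
  case: upper_box_dim E0 => [x||//]; last by exists 1; rewrite ?ltry.
  by rewrite lte_fin => x0; exists (x / 2); rewrite ?lte_fin; lra.
apply: qA_dim_near; near=> delta.
have d0 : 0 < delta by near: delta; exact: nbhs_right_gt.
have ds : delta < s by near: delta; exact: nbhs_right_lt.
apply/eqP; rewrite eq_le qA_h_le1/= (@qA_h_ge1 _ a L)// => J.
(* If the gaps were large from [J] on, the box dimension would be at most [delta], contrary to
   [delta < s]. *)
apply: contrapT => rare.
have : (upper_box_dim (range a : set R^o) <= delta%:E)%E.
  apply: (@upper_box_dim_polynomial_decay _ a L delta J) => // j Jj.
  by rewrite leNgt; apply/negP => gj; apply: rare; exists j.
by rewrite leNgt (lt_trans _ sE)// lte_fin.
Unshelve. all: by end_near. Qed.
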